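(* Let $V=\{v_1,v_2,v_3,v_4\}\subset\mathbb{R}^3$ be the set of vertices of a (non-degenerate) tetrahedron $T=\mathrm{co}(V)$ with circumradius $r(V)$ and circumcenter $c(V)$. If $T$ is well-centered, that is, if $c(V)\in\mathrm{int}(T)$, then $$r_L(V)>r(V),$$ and, with $R^*=r_L(V)$, $$\mathrm{co}_{R^*}(V)=V\cup\{O^*\},$$ where $O^*$ is a point of $\mathrm{int}(T)$ common to the four spheres $\partial B_i(R^* )$, $1\le i\le4$.
   Context: For a non-empty closed set $E\subset\mathbb{R}^3$ and $\rho>0$, the $\rho$-hulloid of $E$ is $\mathrm{co}_\rho(E)=\bigcap B^c$, the intersection over all open balls $B$ of radius $\rho$ with $B\cap E=\emptyset$ (equal to $\mathbb{R}^3$ if there are no such balls). The circumradius $r(V)$ and circumcenter $c(V)$ are the radius and center of the unique sphere containing $V$. The $\rho$-hulloid of $V$ is called full if $\mathrm{int}(\mathrm{co}_\rho(V))\neq\emptyset$, and $r_L(V)=\inf\{\rho>r(V):\ \mathrm{co}_\rho(V)\text{ is full}\}$. For $\rho>r(V)$ and $1\le i\le4$, $B_i(\rho)$ denotes the unique open ball of radius $\rho$ such that $V\setminus\{v_i\}\subset\partial B_i(\rho)$ and $v_i\notin B_i(\rho)$. *)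

(* Defs.v *)
From HB Require Import structures.
From mathcomp Require Import all_boot all_order all_algebra.
From mathcomp Require Import all_classical all_reals all_analysis.

Set Implicit Arguments.
Unset Strict Implicit.
Unset Printing Implicit Defensive.

Import Order.TTheory GRing.Theory Num.Theory.
Import numFieldNormedType.Exports.

Local Open Scope classical_set_scope.
Local Open Scope ring_scope.

Section Defs.
Context {R : realType}.

(* The library norm on 'rV[R]_n is the sup norm, hence explicit Euclidean
   balls and spheres. The topology (used for interior and closure) is the
   library's, which is the usual one. *)
Definition edist n (x y : 'rV[R]_n) : R :=
  Num.sqrt (\sum_(i < n) (x ord0 i - y ord0 i) ^+ 2).

Definition eball n (c : 'rV[R]_n) (r : R) : set 'rV[R]_n :=
  [set x | edist c x < r].

Definition esphere n (c : 'rV[R]_n) (r : R) : set 'rV[R]_n :=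
  [set x | edist c x = r].

Definition boundary n (A : set 'rV[R]_n) : set 'rV[R]_n :=
  closure A `\` interior A.

Definition affinely_independent m n (v : 'I_m -> 'rV[R]_n) : Prop :=
  forall a : 'I_m -> R,
    \sum_i a i = 0 -> \sum_i a i *: v i = 0 -> forall i, a i = 0.

Definition convex_hull n (A : set 'rV[R]_n) : set 'rV[R]_n :=
  smallest (@convex_set R 'rV[R]_n) A.

(* The intersection of an empty family is setT. *)
Definition hulloid (rho : R) (E : set 'rV[R]_3) : set 'rV[R]_3 :=
  \bigcap_(c in [set c | eball c rho `&` E = set0]) ~` eball c rho.

Definition hulloid_full (rho : R) (E : set 'rV[R]_3) : Prop :=
  interior (hulloid rho E) !=set0.

(* [get] returns the element of a singleton; the sphere through the vertices
   of a non-degenerate tetrahedron exists and is unique. *)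
Definition circumcenter (V : set 'rV[R]_3) : 'rV[R]_3 :=
  get [set c | exists r, V `<=` esphere c r].

Definition circumradius (V : set 'rV[R]_3) : R :=
  get [set r | exists c, V `<=` esphere c r].

Definition lower_radius (V : set 'rV[R]_3) : R :=
  inf [set rho | circumradius V < rho /\ hulloid_full rho V].

(* B_i(rho) for x = v_i; meaningful when circumradius V < rho, where exactly
   one such ball exists. *)
Definition facet_ball (V : set 'rV[R]_3) (x : 'rV[R]_3) (rho : R) :
    set 'rV[R]_3 :=
  get [set B | exists c, [/\ B = eball c rho,
                             V `\ x `<=` boundary B & ~ B x]].

End Defs.

(* Main.v *)
(** Put the origin at the circumcenter, let [u_i] be the vertices, [r] the
    circumradius, [bary_i] the barycentric coordinates and [q = rho^2 - r^2].
    A ball of radius [rho] centered at [y] avoids the vertices iff the powers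
    [gap_i y = |y|^2 - 2 y.u_i - q] are nonnegative. The vector [y] is a linear
    function of its powers, hence a combination of the centers [c_i] of the
    facet balls with weights [gap_i y / G_i], where [G_i] is the power of
    [c_i] with respect to [u_i]; convexity of the square norm forces these
    weights to have sum at least [1]. Since
    [sum_i bary_i x * gap_i y = |x - y|^2 - |x|^2 - q], only the balls [c_i]
    matter: [x] is in the hulloid iff [|x| <= r] and
    [r^2 - |x|^2 <= bary_i x * G_i] for all [i].

    For [|x| < r] put [nu_i = bary_i x / (r^2 - |x|^2)]. Then [nu] is a zero of
    the quadratic function
    [excess nu = r^2 (sum nu)^2 - |sum nu_i u_i|^2 - sum nu], and [x] is in the
    hulloid iff [1 / G_i <= nu_i] for all [i]. The [G_i] increase with [q], and
    [excess (1 / G)] is positive at [q = 0] (this uses well-centeredness) and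
    negative for large [q]. At a root the gradient of [excess] is positive, so
    there [1 / G] is the only zero above [1 / G]; it is the extra point of the
    critical hulloid. For smaller [q] there is none, and for larger [q] that
    point is interior. *)
Require Import Defs.
From mathcomp Require Import all_boot all_order all_algebra.
From mathcomp Require Import all_classical all_reals all_analysis.
From mathcomp Require Import ring lra.
Set Implicit Arguments.
Unset Strict Implicit.
Unset Printing Implicit Defensive.
Import Order.TTheory GRing.Theory Num.Theory.
Import numFieldNormedType.Exports.
Local Open Scope classical_set_scope.
Local Open Scope ring_scope.

(** * Euclidean inner product *)

Section EuclideanDot.
Context {R : realType} {n : nat}.
Implicit Types (x y z : 'rV[R]_n) (k : R).

Definition dot x y : R := \sum_(i < n) x ord0 i * y ord0 i.

Lemma dotC x y : dot x y = dot y x.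
Proof. by apply: eq_bigr => i _; rewrite mulrC. Qed.

Lemma dotDl x y z : dot (x + y) z = dot x z + dot y z.
Proof.
by rewrite /dot -big_split; apply: eq_bigr => i _; rewrite mxE mulrDl.
Qed.

Lemma dotDr x y z : dot x (y + z) = dot x y + dot x z.
Proof. by rewrite dotC dotDl !(dotC x). Qed.

Lemma dotZl k x y : dot (k *: x) y = k * dot x y.
Proof. by rewrite /dot mulr_sumr; apply: eq_bigr => i _; rewrite mxE mulrA. Qed.

Lemma dotZr k x y : dot x (k *: y) = k * dot x y.
Proof. by rewrite dotC dotZl dotC. Qed.

Lemma dotNl x y : dot (- x) y = - dot x y.
Proof. by rewrite -scaleN1r dotZl mulN1r. Qed.

Lemma dotNr x y : dot x (- y) = - dot x y.
Proof. by rewrite dotC dotNl dotC. Qed.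

Lemma dot0l x : dot 0 x = 0.
Proof. by rewrite -(scale0r 0) dotZl mul0r. Qed.

Definition dotE := (dotDl, dotDr, dotNl, dotNr, dotZl, dotZr).

Lemma dot_suml I (s : seq I) (P : pred I) (f : I -> 'rV[R]_n) y :
  dot (\sum_(i <- s | P i) f i) y = \sum_(i <- s | P i) dot (f i) y.
Proof.
elim/big_rec2: _ => [|i p q _ <-]; first by rewrite dot0l.
by rewrite dotDl.
Qed.

Lemma dot_sumr I (s : seq I) (P : pred I) (f : I -> 'rV[R]_n) y :
  dot y (\sum_(i <- s | P i) f i) = \sum_(i <- s | P i) dot y (f i).
Proof. by rewrite dotC dot_suml; apply: eq_bigr => i _; rewrite dotC. Qed.

Lemma dot_ge0 x : 0 <= dot x x.
Proof. by apply: sumr_ge0 => i _; rewrite -expr2 sqr_ge0. Qed.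

Lemma dot_eq0 x : dot x x = 0 -> x = 0.
Proof.
move=> /psumr_eq0P H; apply/rowP => i; rewrite mxE.
by apply/eqP; rewrite -sqrf_eq0 expr2 H // => j _; rewrite -expr2 sqr_ge0.
Qed.

Lemma dot_gt0 x : x != 0 -> 0 < dot x x.
Proof.
move=> x0; rewrite lt_def dot_ge0 andbT.
by apply: contraNneq x0 => /dot_eq0 ->.
Qed.

Lemma dotB_sqr x y :
  dot (x - y) (x - y) = dot x x - 2 * dot x y + dot y y.
Proof. by rewrite !dotE (dotC y x); ring. Qed.

Lemma CauchySchwarz_dot x y : dot x y ^+ 2 <= dot x x * dot y y.
Proof.
have [->|y0] := eqVneq y 0; first by rewrite dotC !dot0l expr0n mulr0.
have yy := dot_gt0 y0.
rewrite -subr_ge0 -(pmulr_rge0 _ yy).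
have := dot_ge0 (dot y y *: x - dot x y *: y).
by rewrite dotB_sqr !dotE; congr (0 <= _); ring.
Qed.

(** The weights need not sum to 1: with total [W] and combination [s], expand the nonnegative sum of
    [w_i |W c_i - s|^2]. *)
Lemma Jensen_dot (I : finType) (w : I -> R) (c : I -> 'rV[R]_n) :
  (forall i, 0 <= w i) ->
  dot (\sum_i w i *: c i) (\sum_i w i *: c i) <=
    (\sum_i w i) * \sum_i w i * dot (c i) (c i).
Proof.
move=> w0; set s := \sum_i w i *: c i; set W := \sum_i w i.
have W0 : 0 <= W by apply: sumr_ge0.
have [W00|WN0] := eqVneq W 0.
  have wz i : w i = 0 by move/psumr_eq0P: W00; apply.
  by rewrite W00 mul0r /s big1 ?dot0l // => i _; rewrite wz scale0r.
have Wp : 0 < W by rewrite lt_def WN0.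
have : 0 <= \sum_i w i * dot (W *: c i - s) (W *: c i - s).
  by apply: sumr_ge0 => i _; rewrite mulr_ge0 // dot_ge0.
have -> : \sum_i w i * dot (W *: c i - s) (W *: c i - s) =
   W * (W * (\sum_i w i * dot (c i) (c i)) - dot s s).
  transitivity (W ^+ 2 * (\sum_i w i * dot (c i) (c i))
      - W * 2 * (\sum_i w i * dot (c i) s) + W * dot s s).
    have -> : W * dot s s = \sum_i w i * dot s s by rewrite -mulr_suml.
    rewrite !mulr_sumr -sumrB -big_split /=; apply: eq_bigr => i _.
    by rewrite dotB_sqr !dotE; ring.
  have -> : \sum_i w i * dot (c i) s = dot s s.
    by rewrite {2}/s dot_suml; apply: eq_bigr => i _; rewrite dotZl.
  by ring.
by rewrite pmulr_rge0 // subr_ge0.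
Qed.

Lemma edistE x y : Defs.edist x y = Num.sqrt (dot (x - y) (x - y)).
Proof. by congr Num.sqrt; apply: eq_bigr => i _; rewrite !mxE expr2. Qed.

Lemma edist_ltE x y k : 0 < k ->
  (Defs.edist x y < k) = (dot (x - y) (x - y) < k ^+ 2).
Proof.
move=> k0; rewrite edistE -{1}(gtr0_norm k0) -sqrtr_sqr ltr_sqrt //.
by rewrite exprn_gt0.
Qed.

Lemma edist_eqE x y k : 0 <= k ->
  Defs.edist x y = k <-> dot (x - y) (x - y) = k ^+ 2.
Proof.
move=> k0; rewrite edistE; split=> [<-|->]; last by rewrite sqrtr_sqr ger0_norm.
by rewrite sqr_sqrtr // dot_ge0.
Qed.

End EuclideanDot.

(* [u] are the vertices relative to the circumcenter, [lam] the barycentric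
   coordinates of the circumcenter, and [a] the gradients of the barycentric
   coordinates. *)
Record circumframe {R : realType} (u a : 'I_4 -> 'rV[R]_3) (lam : 'I_4 -> R)
    (r : R) : Prop := Circumframe {
  frame_lam_gt0 : forall i, 0 < lam i;
  frame_lam_sum : \sum_i lam i = 1;
  frame_center : \sum_i lam i *: u i = 0;
  frame_dual_sum : \sum_i a i = 0;
  frame_dual : forall i j, dot (a i) (u j) = (i == j)%:R - lam i;
  frame_dual_expand : forall y, \sum_i dot y (u i) *: a i = y;
  frame_expand : forall y, \sum_i dot y (a i) *: u i = y;
  frame_radius_ge0 : 0 <= r;
  frame_sphere : forall i, dot (u i) (u i) = r ^+ 2
}.

Lemma continuous_sumr (R : realType) (T : topologicalType) m
    (f : 'I_m -> T -> R) :
  (forall i, continuous (f i)) -> continuous (fun x => \sum_i f i x).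
Proof. by move=> fc; apply: continuous_big => //; exact: add_continuous. Qed.

Lemma ord4_neq (i : 'I_4) : exists j : 'I_4, j != i.
Proof.
by exists (if i == ord0 then ord_max else ord0); case: i => -[|?].
Qed.

(** * Barycentric coordinates, powers and facet balls *)

Section Circumframe.
Context {R : realType} (u a : 'I_4 -> 'rV[R]_3) (lam : 'I_4 -> R) (r : R).
Context (F : circumframe u a lam r).
Implicit Types (x y : 'rV[R]_3) (q : R).

Let lam0 := frame_lam_gt0 F.

Definition bary y i : R := lam i + dot y (a i).

Lemma bary_sum y : \sum_i bary y i = 1.
Proof.
by rewrite big_split /= (frame_lam_sum F) -dot_sumr (frame_dual_sum F) dotC
  dot0l addr0.
Qed.

Lemma bary_comb y : \sum_i bary y i *: u i = y.
Proof.
under eq_bigr do rewrite scalerDl.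
by rewrite big_split /= (frame_center F) (frame_expand F) add0r.
Qed.

Lemma bary_uniq (mu : 'I_4 -> R) i :
  \sum_j mu j = 1 -> bary (\sum_j mu j *: u j) i = mu i.
Proof.
move=> mu1; rewrite /bary dot_suml.
under eq_bigr do rewrite dotZl dotC (frame_dual F) mulrBr.
rewrite sumrB -mulr_suml mu1 mul1r addrC subrK (bigD1 i) //= eqxx mulr1.
by rewrite big1 ?addr0 // => j; rewrite eq_sym => /negPf ->; rewrite mulr0.
Qed.

Lemma bary_vertex i j : bary (u i) j = (j == i)%:R.
Proof. by rewrite /bary dotC (frame_dual F) addrC subrK. Qed.

Lemma lam_lt1 i : lam i < 1.
Proof.
have [j ji] := ord4_neq i.
rewrite -(frame_lam_sum F) (bigD1 i) //= ltrDl (bigD1 j) //=.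
by rewrite ltr_pwDl // sumr_ge0 // => k _; apply: ltW.
Qed.

Lemma dual_norm_gt0 i : 0 < dot (a i) (a i).
Proof.
apply: dot_gt0; apply/eqP => ai0.
have := frame_dual F i i; rewrite ai0 dot0l eqxx /= => h.
by have := lam_lt1 i; lra.
Qed.

(* The power of [y] with respect to the sphere of squared radius [q + r^2]
   centered at [u i]. *)
Definition gap q y i : R := dot y y - 2 * dot y (u i) - q.

Lemma gapE q y i :
  gap q y i = dot (y - u i) (y - u i) - (q + r ^+ 2).
Proof. by rewrite dotB_sqr (frame_sphere F) /gap; ring. Qed.

(** The part of [gap] common to all [i] drops out because the [a i] sum to zero. *)
Lemma gap_comb q y : y = - (1 / 2) *: \sum_i gap q y i *: a i.
Proof.
have -> : \sum_i gap q y i *: a i =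
    (dot y y - q) *: (\sum_i a i) - 2 *: \sum_i dot y (u i) *: a i.
  rewrite !scaler_sumr -sumrB; apply: eq_bigr => i _.
  by rewrite scalerA -scalerBl /gap; congr (_ *: _); ring.
rewrite (frame_dual_sum F) (frame_dual_expand F) scaler0 sub0r scalerN scalerA.
by rewrite -scaleNr [X in X *: _](_ : _ = 1) ?scale1r //; field.
Qed.

Lemma gap_lam_sum q y : \sum_i lam i * gap q y i = dot y y - q.
Proof.
transitivity ((dot y y - q) * \sum_i lam i
   - 2 * dot y (\sum_i lam i *: u i)).
  rewrite dot_sumr !mulr_sumr -sumrB; apply: eq_bigr => i _.
  by rewrite dotZr /gap; ring.
by rewrite (frame_lam_sum F) (frame_center F) dotC dot0l; ring.
Qed.

(** [gap] is affine in [u i], so averaging with the weights [bary x] replaces [u i] by [x]. *)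
Lemma gap_bary_sum q x y :
  \sum_i bary x i * gap q y i = dot (x - y) (x - y) - dot x x - q.
Proof.
transitivity ((dot y y - q) * \sum_i bary x i
   - 2 * dot y (\sum_i bary x i *: u i)).
  rewrite dot_sumr !mulr_sumr -sumrB; apply: eq_bigr => i _.
  by rewrite dotZr /gap; ring.
by rewrite bary_sum bary_comb dotB_sqr (dotC y x); ring.
Qed.

(* The positive root [g] of [|a_i|^2 g^2 / 4 - lam_i g - q = 0]: with it,
   [facet_center] is at distance [sqrt (q + r^2)] from the vertices other
   than [u i], and [facet_gap] is its power with respect to [u i]. *)
Definition facet_gap q i : R :=
  2 * (lam i + Num.sqrt (lam i ^+ 2 + dot (a i) (a i) * q)) / dot (a i) (a i).

Definition facet_center q i : 'rV[R]_3 := - (facet_gap q i / 2) *: a i.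

Lemma facet_gap_root q i : 0 <= q ->
  dot (a i) (a i) * facet_gap q i ^+ 2 / 4 - lam i * facet_gap q i = q.
Proof.
move=> q0; rewrite /facet_gap; set A := dot _ _; set s := Num.sqrt _.
have A0 : 0 < A by exact: dual_norm_gt0.
have sE : s ^+ 2 = lam i ^+ 2 + A * q.
  by rewrite sqr_sqrtr // addr_ge0 ?sqr_ge0 // mulr_ge0 // ltW.
have -> : q = (s ^+ 2 - lam i ^+ 2) / A by rewrite sE; field; lra.
by field; lra.
Qed.

Lemma facet_gap_gt0 q i : 0 < facet_gap q i.
Proof.
have A0 := dual_norm_gt0 i; have l0 := lam0 i.
by rewrite /facet_gap divr_gt0 // mulr_gt0 // ltr_pwDl // sqrtr_ge0.
Qed.

Lemma facet_gap_lt q q' i : 0 <= q -> q < q' -> facet_gap q i < facet_gap q' i.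
Proof.
move=> q0 qq'; have A0 := dual_norm_gt0 i; have l0 := lam0 i.
rewrite /facet_gap ltr_pM2r ?invr_gt0 // ltr_pM2l // ltrD2l ltr_sqrt.
  by rewrite ltrD2l ltr_pM2l.
by rewrite ltr_pwDl ?exprn_gt0 // mulr_ge0 // ?ltW //; lra.
Qed.

Lemma gap_facet_center q i j : 0 <= q ->
  gap q (facet_center q i) j = (i == j)%:R * facet_gap q i.
Proof.
move=> q0; rewrite /gap /facet_center !dotE (frame_dual F).
by move: (facet_gap_root i q0); set G := facet_gap q i => h; lra.
Qed.

Lemma facet_center_sqr q i : 0 <= q ->
  dot (facet_center q i) (facet_center q i) = q + lam i * facet_gap q i.
Proof.
move=> q0; rewrite /facet_center !dotE.
by move: (facet_gap_root i q0); set G := facet_gap q i => h; lra.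
Qed.

Lemma gap_facet_comb q y :
  y = \sum_i (gap q y i / facet_gap q i) *: facet_center q i.
Proof.
rewrite {1}(gap_comb q y) scaler_sumr; apply: eq_bigr => i _.
rewrite /facet_center !scalerA; congr (_ *: _).
by have := facet_gap_gt0 q i => h; field; lra.
Qed.

(* Convexity of [y |-> |y|^2], applied to the combination [gap_facet_comb]. *)
Lemma gap_facet_sum_ge1 q y : 0 < q -> (forall i, 0 <= gap q y i) ->
  1 <= \sum_i gap q y i / facet_gap q i.
Proof.
move=> q0 gap0; rewrite leNgt; apply/negP => s1.
have w0 i : 0 <= gap q y i / facet_gap q i.
  by rewrite divr_ge0 // ltW // facet_gap_gt0.
have := Jensen_dot (facet_center q) w0; rewrite -gap_facet_comb.
have -> : dot y y = q + \sum_i lam i * gap q y i.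
  by rewrite gap_lam_sum; ring.
set s := \sum_i _ / _ in s1 *.
have -> : \sum_i gap q y i / facet_gap q i *
      dot (facet_center q i) (facet_center q i) =
    s * q + \sum_i lam i * gap q y i.
  rewrite mulr_suml -big_split; apply: eq_bigr => i _ /=.
  rewrite facet_center_sqr ?ltW // mulrDr; congr (_ + _).
  by have := facet_gap_gt0 q i => h; field; lra.
have s0 : 0 <= s by apply: sumr_ge0.
have L0 : 0 <= \sum_i lam i * gap q y i.
  by apply: sumr_ge0 => i _; rewrite mulr_ge0 // ltW.
set L := \sum_i _ in L0 *.
(* Jensen gives [q + L <= s (s q + L)]; for [s < 1] this is at most [s q + L], against [q > 0]. *)
have h1 : 0 <= (1 - s) * (s * q + L).
  by rewrite mulr_ge0 ?subr_ge0 ?(ltW s1) // addr_ge0 // mulr_ge0 // ltW.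
have h2 : 0 < (1 - s) * q by rewrite mulr_gt0 // subr_gt0.
by lra.
Qed.

(** The zero powers make [y] a multiple [w] of the facet center, and [w] solves a quadratic equation
    with 1 as its only nonnegative root. The sign condition discards the other sphere through the
    facet. *)
Lemma facet_center_uniq q i y : 0 < q -> 0 <= gap q y i ->
  (forall j, j != i -> gap q y j = 0) -> y = facet_center q i.
Proof.
move=> q0 gi gj; have G0 := facet_gap_gt0 q i.
set w := gap q y i / facet_gap q i.
have w0 : 0 <= w by rewrite divr_ge0 // ltW.
have yE : y = w *: facet_center q i.
  rewrite (gap_facet_comb q y) (bigD1 i) //= big1 ?addr0 // => j ji.
  by rewrite gj // mul0r scale0r.
have := gap_lam_sum q y.
rewrite (bigD1 i) //= big1 ?addr0 => [|j ji]; last by rewrite gj // mulr0.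
have -> : gap q y i = w * facet_gap q i by rewrite /w; field; lra.
have -> : dot y y = w ^+ 2 * (q + lam i * facet_gap q i).
  by rewrite {1 2}yE dotZl dotZr facet_center_sqr ?ltW // mulrA expr2.
move=> h.
have lG : 0 < lam i * facet_gap q i by rewrite mulr_gt0.
have : (w - 1) * ((w + 1) * q + w * (lam i * facet_gap q i)) = 0.
  by lra.
move/eqP; rewrite mulf_eq0 => /orP [/eqP w1|/eqP h0].
  by rewrite yE (_ : w = 1) ?scale1r //; lra.
have h1 : 0 <= w * q by rewrite mulr_ge0 // ltW.
have h2 : 0 <= w * (lam i * facet_gap q i) by rewrite mulr_ge0 // ltW.
exfalso; lra.
Qed.

(** Describes the hulloid of squared radius [q + r^2] by the facet balls alone. The undivided form
    also makes sense on the circumsphere, where [r^2 - |x|^2] vanishes. *)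
Definition in_core q x : Prop :=
  dot x x <= r ^+ 2 /\ forall i, r ^+ 2 - dot x x <= bary x i * facet_gap q i.

(* Outside of the circumsphere, the center [y] of an excluding ball is taken on
   the ray through [x]. *)
Lemma in_coreP q x : 0 < q ->
  in_core q x <->
  forall y, (forall i, 0 <= gap q y i) -> q + r ^+ 2 <= dot (x - y) (x - y).
Proof.
move=> q0; split=> [[xr xG] y gap0|H].
  have s1 := gap_facet_sum_ge1 q0 gap0.
  have h : (r ^+ 2 - dot x x) * (\sum_i gap q y i / facet_gap q i) <=
      \sum_i bary x i * gap q y i.
    rewrite mulr_sumr; apply: ler_sum => i _; have G0 := facet_gap_gt0 q i.
    have -> : bary x i * gap q y i =
        bary x i * facet_gap q i * (gap q y i / facet_gap q i) by field; lra.
    by rewrite ler_wpM2r ?xG // divr_ge0 // ltW.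
  move: h; rewrite gap_bary_sum => h.
  have xr' : 0 <= r ^+ 2 - dot x x by rewrite subr_ge0.
  by have := ler_wpM2l xr' s1; lra.
split; last first.
  move=> i; have G0 := facet_gap_gt0 q i.
  (* Test on the [i]-th facet center, whose only nonzero power is the [i]-th. *)
  have := gap_bary_sum q x (facet_center q i).
  rewrite (bigD1 i) //= big1 ?addr0 => [|j ji]; last first.
    by rewrite gap_facet_center ?ltW // eq_sym (negPf ji) mul0r mulr0.
  rewrite gap_facet_center ?(ltW q0) // eqxx mul1r => ->.
  suff gap0 j : 0 <= gap q (facet_center q i) j by have := H _ gap0; lra.
  by rewrite gap_facet_center ?(ltW q0) // mulr_ge0 // ltW.
rewrite leNgt; apply/negP => rx.
have r0 := frame_radius_ge0 F.
pose X := Num.sqrt (dot x x); pose rho := Num.sqrt (q + r ^+ 2).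
have X2 : X ^+ 2 = dot x x by rewrite sqr_sqrtr // dot_ge0.
have rho2 : rho ^+ 2 = q + r ^+ 2.
  by rewrite sqr_sqrtr // addr_ge0 ?sqr_ge0 // ltW.
have rX : r < X.
  by rewrite -(ger0_norm r0) -sqrtr_sqr ltr_sqrt // (le_lt_trans _ rx) ?sqr_ge0.
have rho0 : 0 < rho by rewrite sqrtr_gt0 ltr_pwDl // sqr_ge0.
have X0 : 0 < X by lra.
(* A center at distance [t >= r + rho] from the origin keeps its ball off the vertices, while
   [0 <= t - X < rho] puts [x] in the ball. *)
pose t := Num.max (r + rho) X.
have t1 : r + rho <= t by rewrite le_max lexx.
have t2 : X <= t by rewrite le_max lexx orbT.
have t3 : t - X < rho by rewrite ltrBlDr gt_max; apply/andP; split; lra.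
suff /H : forall i, 0 <= gap q ((t / X) *: x) i.
  rewrite dotB_sqr !dotE -X2 -rho2.
  have -> : X ^+ 2 - 2 * (t / X * X ^+ 2) + t / X * (t / X * X ^+ 2) =
    (t - X) ^+ 2 by field; lra.
  by apply/negP; rewrite -ltNge ltr_pXn2r ?nnegrE //; lra.
move=> i.
have xu : dot x (u i) <= X * r.
  have := CauchySchwarz_dot x (u i); rewrite (frame_sphere F) -X2 -exprMn.
  move=> CS; apply: (le_trans (ler_norm _)).
  by rewrite -(@ler_pXn2r _ 2) // ?nnegrE ?mulr_ge0 ?(ltW X0) ?real_normK
    ?num_real.
rewrite /gap !dotE -X2.
have -> : t / X * (t / X * X ^+ 2) = t ^+ 2 by field; lra.
have -> : dot x (u i) = X * r - (X * r - dot x (u i)) by ring.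
have -> : q = rho ^+ 2 - r ^+ 2 by rewrite rho2; ring.
set e := X * r - dot x (u i); have e0 : 0 <= e by rewrite subr_ge0.
have -> : 2 * (t / X * (X * r - e)) = 2 * t * r - 2 * (t / X * e).
  by field; lra.
have h1 : 0 <= t / X * e by rewrite mulr_ge0 // divr_ge0 //; lra.
have h2 : 0 <= (t - r - rho) * (t - r + rho) by rewrite mulr_ge0 //; lra.
by lra.
Qed.

(** * The quadratic function [excess] and its root *)

(** If [S] is the nonzero sum of [nu] and [x] the barycenter with weights [nu_i / S], this is
    [S^2 (r^2 - |x|^2) - S]: it vanishes iff [S (r^2 - |x|^2) = 1]. *)
Definition excess (nu : 'I_4 -> R) : R :=
  r ^+ 2 * (\sum_i nu i) ^+ 2
  - dot (\sum_i nu i *: u i) (\sum_i nu i *: u i) - \sum_i nu i.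

Lemma excess_bary x (P := r ^+ 2 - dot x x) :
  P != 0 -> excess (fun i => bary x i / P) = 0.
Proof.
move=> P0; rewrite /excess -mulr_suml bary_sum.
have -> : \sum_i (bary x i / P) *: u i = P^-1 *: x.
  rewrite -{2}(bary_comb x) scaler_sumr; apply: eq_bigr => i _.
  by rewrite scalerA mulrC.
rewrite !dotE (_ : dot x x = r ^+ 2 - P); last by rewrite /P; ring.
by field.
Qed.

(* The partial derivatives of [excess] at a zero [tau] are the positive numbers
   [|w - S u_i|^2 / S], where [w = sum_i tau_i u_i] and [S = sum_i tau_i]. *)
Lemma excess_eq0_inj (tau nu : 'I_4 -> R) :
  (forall i, 0 < tau i) -> (forall i, tau i <= nu i) ->
  excess tau = 0 -> excess nu = 0 -> forall i, nu i = tau i.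
Proof.
move=> tau0 taunu; pose d i := nu i - tau i.
have d0 i : 0 <= d i by rewrite subr_ge0.
rewrite /excess.
set S := \sum_i tau i; set w := \sum_i tau i *: u i.
pose D := \sum_i d i; pose z := \sum_i d i *: u i.
have -> : \sum_i nu i = S + D by rewrite /D sumrB addrC subrK.
have -> : \sum_i nu i *: u i = w + z.
  rewrite -big_split; apply: eq_bigr => i _ /=.
  by rewrite -scalerDl addrC subrK.
move=> eT eN.
have S0 : 0 < S.
  rewrite /S (bigD1 ord0) //= ltr_pwDl // sumr_ge0 // => i _; exact: ltW.
pose g i := 2 * r ^+ 2 * S - 2 * dot w (u i) - 1.
have g0 i : 0 < g i.
  rewrite -(pmulr_rgt0 _ S0).
  have -> : S * g i = dot (w - S *: u i) (w - S *: u i).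
    rewrite dotB_sqr !dotE (frame_sphere F) /g.
    have -> : dot w w = r ^+ 2 * S ^+ 2 - S by lra.
    by ring.
  (* [w = S u_i] would give [excess tau = - S]. *)
  apply: dot_gt0; rewrite subr_eq0; apply/eqP => wS.
  by move: eT; rewrite wS !dotE (frame_sphere F); lra.
(* The second-order remainder [r^2 D^2 - |z|^2] at [tau] is nonnegative, so the first-order part, a
   sum of terms [g_i d_i >= 0], must vanish. *)
have zD : dot z z <= r ^+ 2 * D ^+ 2.
  have := Jensen_dot u d0; rewrite -/z -/D.
  under eq_bigr do rewrite (frame_sphere F).
  by rewrite -mulr_suml -/D; lra.
have gd : \sum_i g i * d i = 2 * r ^+ 2 * S * D - 2 * dot w z - D.
  rewrite dot_sumr /D [2 * r ^+ 2 * S * _]mulr_sumr [2 * \sum_i _]mulr_sumr.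
  by rewrite -!sumrB; apply: eq_bigr => i _; rewrite dotZr /g; ring.
have : \sum_i g i * d i = 0.
  apply/eqP; rewrite eq_le sumr_ge0 ?andbT => [|i _]; last first.
    by rewrite mulr_ge0 // ltW.
  by rewrite gd; move: eN; rewrite !dotE (dotC z w); lra.
move/psumr_eq0P => H i; apply/eqP; rewrite -subr_eq0.
have /eqP : g i * d i = 0 by apply: H => // j _; rewrite mulr_ge0 // ltW.
by rewrite mulf_eq0 gt_eqF.
Qed.

(** The coefficients [r^2 - u_i.u_j] are half the squared edge lengths, hence zero on the diagonal.
    This form suits termwise estimates and continuity. *)
Lemma excessE (nu : 'I_4 -> R) :
  excess nu =
  \sum_i nu i * ((\sum_j nu j * (r ^+ 2 - dot (u i) (u j))) - 1).
Proof.
rewrite /excess; set S := \sum_i nu i; set w := \sum_i nu i *: u i.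
have inner i : \sum_j nu j * (r ^+ 2 - dot (u i) (u j)) =
    r ^+ 2 * S - dot (u i) w.
  rewrite dot_sumr mulr_sumr -sumrB; apply: eq_bigr => j _.
  by rewrite dotZr; ring.
under eq_bigr do rewrite inner.
have -> : dot w w = \sum_i nu i * dot (u i) w.
  by rewrite {1}/w dot_suml; apply: eq_bigr => i _; rewrite dotZl.
transitivity ((r ^+ 2 * S - 1) * S - \sum_i nu i * dot (u i) w); first by ring.
by rewrite {2}/S mulr_sumr -sumrB; apply: eq_bigr => i _; ring.
Qed.

(** The [j]-th barycentric coordinate rises by 1 from [u i] to [u j], so Cauchy-Schwarz gives
    [|a_j|^2 |u_j - u_i|^2 >= 1]. Each inner sum is then at least the sum of [1 / (8 lam_j)] over
    [j != i], which exceeds [9 / 8] as these three positive weights sum to less than 1. *)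
Lemma excess_at0 : 0 < excess (fun i => (facet_gap 0 i)^-1).
Proof.
have tauE i : (facet_gap 0 i)^-1 = dot (a i) (a i) / (4 * lam i).
  rewrite /facet_gap mulr0 addr0 sqrtr_sqr gtr0_norm //.
  have A0 := dual_norm_gt0 i; have l0 := lam0 i.
  by field; apply/andP; split; lra.
suff term_gt0 i : 0 < (facet_gap 0 i)^-1 *
    ((\sum_j (facet_gap 0 j)^-1 * (r ^+ 2 - dot (u i) (u j))) - 1).
  rewrite excessE (bigD1 ord0) //= ltr_pwDl // sumr_ge0 // => i _.
  exact: ltW.
rewrite mulr_gt0 ?invr_gt0 ?facet_gap_gt0 // subr_gt0.
rewrite (bigD1 i) //= (frame_sphere F) subrr mulr0 add0r.
(* [1 / l >= 6 - 9 l] is the tangent at [l = 1 / 3], the equality case of the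
   harmonic mean inequality for three weights. *)
have bound j : j != i ->
    (6 - 9 * lam j) / 8 <= (facet_gap 0 j)^-1 * (r ^+ 2 - dot (u i) (u j)).
  move=> ji; rewrite tauE; have l0 := lam0 j; have A0 := dual_norm_gt0 j.
  have CS := CauchySchwarz_dot (a j) (u j - u i).
  have pE : r ^+ 2 - dot (u i) (u j) = dot (u j - u i) (u j - u i) / 2.
    by rewrite dotB_sqr !(frame_sphere F) (dotC (u j)); field.
  move: CS; rewrite pE dotDr dotNr !(frame_dual F) eqxx (negPf ji) /=.
  set A := dot (a j) _; set L := dot (u j - u i) _ => CS.
  have AL : 1 <= A * L by lra.
  have -> : A / (4 * lam j) * (L / 2) = A * L / lam j / 8 by field; lra.
  rewrite ler_pM2r ?invr_gt0 // ler_pdivlMr //.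
  by have := sqr_ge0 (3 * lam j - 1); lra.
have : \sum_(j | j != i) (6 - 9 * lam j) / 8 <=
   \sum_(j | j != i) (facet_gap 0 j)^-1 * (r ^+ 2 - dot (u i) (u j)).
  by apply: ler_sum.
apply: lt_le_trans.
have : \sum_j (6 - 9 * lam j) / 8 = 15 / 8.
  rewrite -mulr_suml sumrB -mulr_sumr (frame_lam_sum F) sumr_const card_ord.
  by rewrite -mulr_natr; congr (_ / _); lra.
rewrite (bigD1 i) //=; have := lam0 i; set s := \sum_(j | _) _.
by lra.
Qed.

Lemma excess_large :
  exists2 q, 0 < q & excess (fun i => (facet_gap q i)^-1) < 0.
Proof.
(* If every facet gap is at least [K], then [S <= 4 / K] and [r^2 S < 1]. A gap [G < K] would give
   [q = |a_i|^2 G^2 / 4 - lam_i G < |a_i|^2 K^2 / 4], so [q] is taken above all these bounds. *)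
pose K := 8 * r ^+ 2 + 8; have r2 : 0 <= r ^+ 2 by rewrite sqr_ge0.
pose q := K ^+ 2 / 4 * \sum_i dot (a i) (a i).
have Aq i : dot (a i) (a i) * K ^+ 2 / 4 <= q.
  rewrite /q [X in X <= _](_ : _ = K ^+ 2 / 4 * dot (a i) (a i)); last by field.
  rewrite ler_wpM2l ?divr_ge0 ?sqr_ge0 // (bigD1 i) //= lerDl.
  rewrite sumr_ge0 // => j _.
  exact: dot_ge0.
have q0 : 0 < q.
  apply: lt_le_trans (Aq ord0); rewrite divr_gt0 // mulr_gt0 ?dual_norm_gt0 //.
  by rewrite exprn_gt0 // /K; lra.
exists q => //.
have KG i : K <= facet_gap q i.
  rewrite leNgt; apply/negP => GK; have G0 := facet_gap_gt0 q i.
  have h := facet_gap_root i (ltW q0); have A0 := dual_norm_gt0 i.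
  have lG : 0 < lam i * facet_gap q i by rewrite mulr_gt0.
  have GK2 : facet_gap q i ^+ 2 <= K ^+ 2.
    by rewrite ler_pXn2r ?nnegrE ?(ltW G0) ?(ltW GK) //; lra.
  have := ler_wpM2l (ltW A0) GK2; have := Aq i.
  by lra.
rewrite /excess; set S := \sum_i _; set w := \sum_i _ *: _.
have S0 : 0 < S.
  rewrite /S (bigD1 ord0) //= ltr_pwDl ?invr_gt0 ?facet_gap_gt0 //.
  by rewrite sumr_ge0 // => i _; rewrite invr_ge0 ltW // facet_gap_gt0.
have SK : S <= 4 / K.
  rewrite (_ : 4 / K = \sum_(i < 4) K^-1); last first.
    by rewrite sumr_const card_ord mulr_natl.
  apply: ler_sum => i _; rewrite lef_pV2 ?posrE ?facet_gap_gt0 //.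
  by rewrite /K; lra.
have rS : r ^+ 2 * S < 1.
  apply: (le_lt_trans (ler_wpM2l r2 SK)).
  by rewrite mulrA ltr_pdivrMr /K; lra.
have h : S * (r ^+ 2 * S - 1) < 0 by rewrite pmulr_rlt0 // subr_lt0.
by have := dot_ge0 w; lra.
Qed.

Lemma facet_gap_continuous i : continuous (facet_gap ^~ i).
Proof.
move=> q; rewrite /facet_gap; apply: cvgM; last exact: cvg_cst.
apply: cvgM; first exact: cvg_cst.
apply: cvgD; first exact: cvg_cst.
apply: (@continuous_comp _ _ _ (fun q => lam i ^+ 2 + dot (a i) (a i) * q)
  Num.sqrt); last exact: sqrt_continuous.
apply: cvgD; first exact: cvg_cst.
by apply: cvgM; [exact: cvg_cst | exact: cvg_id].
Qed.

Lemma excess_root : exists2 q, 0 < q & excess (fun i => (facet_gap q i)^-1) = 0.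
Proof.
have [Q Q0 fQ] := excess_large; have f0 := excess_at0.
pose f q := excess (fun i => (facet_gap q i)^-1).
have fc : continuous f.
  have -> : f = fun q => \sum_i (facet_gap q i)^-1 *
      ((\sum_j (facet_gap q j)^-1 * (r ^+ 2 - dot (u i) (u j))) - 1).
    by apply/funext => q; exact: excessE.
  have tc i : continuous (fun q => (facet_gap q i)^-1).
    move=> q; apply: cvgV; last exact: facet_gap_continuous.
    by rewrite gt_eqF // facet_gap_gt0.
  apply: continuous_sumr => i q; apply: cvgM; first exact: tc.
  apply: cvgB; last exact: cvg_cst.
  apply: (@continuous_sumr _ _ _ (fun j q => (facet_gap q j)^-1 *
    (r ^+ 2 - dot (u i) (u j)))) => j {}q.
  by apply: cvgM; [exact: tc | exact: cvg_cst].
have := @IVT _ f 0 Q 0 (ltW Q0) (continuous_subspaceT fc).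
case=> [|q].
  by rewrite ge_min le_max (ltW fQ) (ltW f0) orbT.
rewrite in_itv /= => /andP [q0 _] fq; exists q => //.
rewrite lt_def q0 andbT; apply/eqP => q00.
by move: f0 fq; rewrite q00 /f => + e0; rewrite e0 ltxx.
Qed.

(** * The vertices and the extra point *)

Lemma in_core_vertex q i : in_core q (u i).
Proof.
rewrite /in_core (frame_sphere F) lexx subrr; split=> // j.
by rewrite bary_vertex mulr_ge0 // ltW // facet_gap_gt0.
Qed.

(** Strict convexity of the ball: here the barycentric coordinates are nonnegative and the sum of
    [bary x i |x - u_i|^2] is [r^2 - |x|^2 = 0]. *)
Lemma in_core_sphere q x : in_core q x -> dot x x = r ^+ 2 -> exists i, x = u i.
Proof.
move=> [_ xG] xr.
have b0 i : 0 <= bary x i.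
  by rewrite -(pmulr_lge0 _ (facet_gap_gt0 q i)) (le_trans _ (xG i)) //
    xr subrr.
have sum0 : \sum_i bary x i * dot (x - u i) (x - u i) = 0.
  have := gap_bary_sum q x x.
  under eq_bigr do rewrite gapE mulrBr.
  rewrite sumrB -mulr_suml bary_sum subrr dot0l xr.
  set s := \sum_i _ => h; lra.
have [i bi|b00] := pickP (fun i => bary x i != 0); last first.
  exfalso; have := bary_sum x; rewrite big1 => [|i _]; first by lra.
  by apply/eqP/negbFE/b00.
exists i; apply/eqP; rewrite -subr_eq0; apply/eqP/dot_eq0/eqP.
have /psumr_eq0P H := sum0.
have /eqP : bary x i * dot (x - u i) (x - u i) = 0.
  by apply: H => // j _; rewrite mulr_ge0 // dot_ge0.
by rewrite mulf_eq0 (negPf bi).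
Qed.

(** At a root of [excess], the point where all four inequalities of [in_core] are equalities. *)
Definition apex q : 'rV[R]_3 :=
  \sum_i ((facet_gap q i)^-1 / \sum_j (facet_gap q j)^-1) *: u i.

Section Apex.
Context (q : R) (q_gt0 : 0 < q).
Context (q_root : excess (fun i => (facet_gap q i)^-1) = 0).

Let S := \sum_i (facet_gap q i)^-1.

Let S_gt0 : 0 < S.
Proof.
rewrite /S (bigD1 ord0) //= ltr_pwDl ?invr_gt0 ?facet_gap_gt0 //.
by rewrite sumr_ge0 // => i _; rewrite invr_ge0 ltW // facet_gap_gt0.
Qed.

Lemma bary_apex i : bary (apex q) i = (facet_gap q i)^-1 / S.
Proof. by rewrite bary_uniq // -mulr_suml divff // gt_eqF // S_gt0. Qed.

Lemma bary_apex_gt0 i : 0 < bary (apex q) i.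
Proof. by rewrite bary_apex divr_gt0 ?S_gt0 // invr_gt0 facet_gap_gt0. Qed.

Lemma apex_power : r ^+ 2 - dot (apex q) (apex q) = S^-1.
Proof.
have h := S_gt0; have SN : S != 0 by rewrite gt_eqF.
have -> : apex q = S^-1 *: \sum_i (facet_gap q i)^-1 *: u i.
  rewrite scaler_sumr; apply: eq_bigr => i _; rewrite scalerA.
  by rewrite [S^-1 * _]mulrC.
move: q_root; rewrite /excess -/S dotZl dotZr; set w := dot _ _ => e.
have -> : w = r ^+ 2 * S ^+ 2 - S by lra.
by field.
Qed.

Lemma bary_apex_facet_gap i :
  bary (apex q) i * facet_gap q i = r ^+ 2 - dot (apex q) (apex q).
Proof.
rewrite bary_apex apex_power mulrAC mulVf ?mul1r //.
by rewrite gt_eqF // facet_gap_gt0.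
Qed.

Lemma apex_inside : dot (apex q) (apex q) < r ^+ 2.
Proof. by rewrite -subr_gt0 apex_power invr_gt0 S_gt0. Qed.

Lemma in_core_apex : in_core q (apex q).
Proof.
split; first exact: ltW apex_inside.
by move=> i; rewrite bary_apex_facet_gap.
Qed.

(** By [gap_bary_sum], equality in the [i]-th inequality of [in_core] means lying on the [i]-th
    facet sphere. *)
Lemma apex_facet_center i :
  dot (apex q - facet_center q i) (apex q - facet_center q i) = q + r ^+ 2.
Proof.
have := gap_bary_sum q (apex q) (facet_center q i).
rewrite (bigD1 i) //= big1 ?addr0 => [|j ji]; last first.
  by rewrite gap_facet_center ?(ltW q_gt0) // eq_sym (negPf ji) mul0r mulr0.
rewrite gap_facet_center ?(ltW q_gt0) // eqxx mul1r bary_apex_facet_gap.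
by lra.
Qed.

(** The zeros [1 / G(q)] and [bary x / P] of [excess] are ordered through [1 / G(q')], so they
    coincide; strict monotonicity of [G] then excludes [q' < q]. *)
Lemma in_core_inside q' x : 0 < q' -> q' <= q ->
  in_core q' x -> dot x x < r ^+ 2 -> q' = q /\ x = apex q.
Proof.
move=> q'0 q'q [_ xG] xr.
set P := r ^+ 2 - dot x x in xG.
have P0 : 0 < P by rewrite subr_gt0.
have tau0 i : 0 < (facet_gap q i)^-1 by rewrite invr_gt0 facet_gap_gt0.
have tau' i : (facet_gap q' i)^-1 <= bary x i / P.
  by rewrite ler_pdivlMr // mulrC ler_pdivrMr ?facet_gap_gt0.
have tautau i : (facet_gap q i)^-1 <= (facet_gap q' i)^-1.
  rewrite lef_pV2 ?posrE ?facet_gap_gt0 //.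
  by move: q'q; rewrite le_eqVlt => /orP [/eqP ->//|?];
    rewrite ltW // facet_gap_lt // ltW.
have PN0 : P != 0 by rewrite gt_eqF.
have E := excess_eq0_inj tau0 (fun i => le_trans (tautau i) (tau' i))
  q_root (excess_bary PN0).
split.
  apply/eqP; rewrite eq_le q'q leNgt; apply/negP => lt_q'q.
  have := facet_gap_lt ord0 (ltW q'0) lt_q'q.
  rewrite -ltf_pV2 ?posrE ?facet_gap_gt0 // -E.
  by rewrite ltNge tau'.
have SP : S = P^-1.
  rewrite /S -[RHS]mul1r -(bary_sum x) mulr_suml.
  by apply: eq_bigr => i _; rewrite -E.
rewrite -(bary_comb x); apply: eq_bigr => i _; congr (_ *: _).
by rewrite -/S SP -E invrK divfK.
Qed.

Lemma in_core_apex_strict q' i : q < q' ->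
  r ^+ 2 - dot (apex q) (apex q) < bary (apex q) i * facet_gap q' i.
Proof.
move=> qq'; rewrite -(bary_apex_facet_gap i) ltr_pM2l ?bary_apex_gt0 //.
exact: facet_gap_lt (ltW q_gt0) qq'.
Qed.

End Apex.

End Circumframe.

(** * Interiors and boundaries of Euclidean balls *)

Section Topology.
Context {R : realType} {n : nat}.
Implicit Types (A : set 'rV[R]_n.+1) (x c d : 'rV[R]_n.+1).

Lemma dot_continuous (T : topologicalType) (f g : T -> 'rV[R]_n.+1) :
  continuous f -> continuous g -> continuous (fun t => dot (f t) (g t)).
Proof.
move=> fc gc; apply: continuous_sumr => i t; apply: cvgM.
  exact: (continuous_comp (fc t) (@coord_continuous _ _ _ _ _ _)).
exact: (continuous_comp (gc t) (@coord_continuous _ _ _ _ _ _)).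
Qed.

Lemma interior_line A x d :
  interior A x -> exists e : R, [/\ 0 < e, e < 1 & A (x + e *: d)].
Proof.
move=> Ax.
have lc : (x + t *: d) @[t --> (0 : R)] --> x.
  rewrite [X in _ --> X](_ : x = x + 0 *: d); last by rewrite scale0r addr0.
  by apply: cvgD; [exact: cvg_cst | apply: cvgZr_tmp; exact: cvg_id].
have /nbhs_ballP [e /= e0 eA] := lc _ Ax.
have m0 : 0 < Num.min (e / 2) (1 / 2 : R) by rewrite lt_min !divr_gt0.
exists (Num.min (e / 2) (1 / 2)); split => //.
  by rewrite gt_min; apply/orP; right; lra.
apply: eA; rewrite /ball /= sub0r normrN gtr0_norm // gt_min; apply/orP; left.
by rewrite ltr_pdivrMr // mulr2n mulrDr mulr1 ltrDl.
Qed.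

Lemma dist_continuous c : continuous (fun x => dot (c - x) (c - x)).
Proof.
have sc : continuous (fun x : 'rV[R]_n.+1 => c - x).
  by move=> x; apply: continuousB; [exact: cst_continuous | exact: cvg_id].
exact: (dot_continuous sc sc).
Qed.

Lemma boundary_eball c (rho : R) : 0 < rho ->
  boundary (eball c rho) = esphere c rho.
Proof.
move=> rho0; apply/seteqP; split=> x.
  move=> [clx intx]; apply/(edist_eqE _ _ (ltW rho0)).
  apply/eqP; rewrite eq_le; apply/andP; split; rewrite leNgt; apply/negP => h.
    have [y []] := clx _ (cvgr_gt _ (@dist_continuous c x) _ h).
    by rewrite /eball /= edist_ltE // => h1 h2; lra.
  apply: intx; apply: filterS (cvgr_lt _ (@dist_continuous c x) _ h) => y.
  by rewrite /eball /= edist_ltE.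
move=> /(edist_eqE _ _ (ltW rho0)) xr; split; last first.
  by move=> /nbhs_singleton; rewrite /eball /= edist_ltE // xr ltxx.
(* Moving from [x] towards [c] by a fraction [e] scales the distance by [1 - e], so every
   neighborhood of [x] meets the ball. *)
move=> N /(@interior_line N x (c - x)) [e [e0 e1 Ne]].
exists (x + e *: (c - x)); split => //; rewrite /eball /= edist_ltE //.
have -> : c - (x + e *: (c - x)) = (1 - e) *: (c - x).
  by rewrite scalerBl scale1r opprD addrA.
rewrite dotZl dotZr mulrA xr -[ltRHS]mul1r ltr_pM2r ?exprn_gt0 //.
have h : 0 < e * (1 - e) by rewrite mulr_gt0 // subr_gt0.
by lra.
Qed.

End Topology.

(** Induction on [m]: join the first point to the combination of the others, rescaled by their total
    weight [s] unless [s = 0]. *)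
Lemma convex_set_sum (R : realType) (E : lmodType R) (A : set E) m
    (mu : 'I_m -> R) (f : 'I_m -> E) :
  @convex_set R E A -> (forall i, A (f i)) -> (forall i, 0 <= mu i) ->
  \sum_i mu i = 1 -> A (\sum_i mu i *: f i).
Proof.
move=> cA; elim: m mu f => [|m IH] mu f Af mu0.
  by rewrite big_ord0 => /eqP; rewrite eq_sym oner_eq0.
rewrite !big_ord_recl; set s := \sum_i mu (lift _ _) => mu1.
have s0 : 0 <= s by apply: sumr_ge0.
have [s00|sN0] := eqVneq s 0.
  rewrite big1 => [|i _]; last first.
    by move/psumr_eq0P: s00 => -> //; rewrite scale0r.
  by rewrite addr0 (_ : mu ord0 = 1) ?scale1r // -mu1 s00 addr0.
have m1 : mu ord0 <= 1 by rewrite -mu1 lerDl.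
have IHs : A (\sum_i (mu (lift ord0 i) / s) *: f (lift ord0 i)).
  apply: IH => // [i|]; first by rewrite divr_ge0.
  by rewrite -mulr_suml divff.
have := cA (f ord0) _ (Itv01 (mu0 ord0) m1) (mem_set (Af ord0)) (mem_set IHs).
rewrite inE; congr A; congr (_ + _).
rewrite /= /unstable.onem -mu1 addrC addKr scaler_sumr.
apply: eq_bigr => i _; rewrite scalerA; congr (_ *: _).
by rewrite mulrC divfK.
Qed.

(** * Affine coordinates of a simplex *)

Section DualBasis.
Context {R : realType} (v : 'I_4 -> 'rV[R]_3).

(** Affine independence makes the matrix with rows [(v_i, 1)] invertible. The columns of its inverse
    are the [(a_i, b_i)], and the identities are entries of the two inverse equations. *)
Lemma dual_basis : affinely_independent v ->
  exists (a : 'I_4 -> 'rV[R]_3) (b : 'I_4 -> R),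
  [/\ \sum_i a i = 0 /\ \sum_i b i = 1, \sum_i b i *: v i = 0,
      forall i j, dot (a i) (v j) + b i = (i == j)%:R,
      forall y, \sum_i dot y (v i) *: a i = y
    & forall y, \sum_i dot y (a i) *: v i = y].
Proof.
move=> vind.
pose M : 'M[R]_(4, 3 + 1) := \matrix_i row_mx (v i) 1%:M.
have Ml i k : M i (lshift 1 k) = v i ord0 k by rewrite mxE row_mxEl.
have Mr i k : M i (rshift 3 k) = 1 by rewrite mxE row_mxEr !ord1 mxE.
clearbody M.
have Mu : (M : 'M[R]_4) \in unitmx.
  rewrite -row_free_unit; apply: inj_row_free => w wM.
  have w1 : \sum_i w ord0 i = 0.
    have /rowP /(_ (rshift 3 ord0)) := wM; rewrite !mxE => h.
    by apply: etrans h; apply: eq_bigr => i _; rewrite Mr mulr1.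
  have w2 : \sum_i w ord0 i *: v i = 0.
    apply/rowP => k; have /rowP /(_ (lshift 1 k)) := wM.
    rewrite !mxE => h; apply: etrans h.
    by rewrite summxE; apply: eq_bigr => i _; rewrite Ml mxE.
  by apply/rowP => i; rewrite mxE; exact: (vind (fun i => w ord0 i)).
pose N : 'M[R]_(3 + 1, 4) := invmx (M : 'M[R]_4).
have MN : M *m N = 1%:M := mulmxV Mu.
have NM : N *m M = 1%:M := mulVmx Mu.
clearbody N.
exists (fun i => \row_k N (lshift 1 k) i), (fun i => N (rshift 3 ord0) i).
have NMll k l : \sum_i N (lshift 1 k) i * v i ord0 l = (k == l)%:R.
  have /matrixP /(_ (lshift 1 k) (lshift 1 l)) := NM.
  rewrite !mxE (inj_eq (@lshift_inj _ _)) => h; apply: etrans h.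
  by apply: eq_bigr => i _; rewrite Ml.
split.
- split.
    apply/rowP => k; rewrite summxE mxE.
    have /matrixP /(_ (lshift 1 k) (rshift 3 ord0)) := NM.
    rewrite !mxE eq_lrshift => h; apply: etrans h.
    by apply: eq_bigr => i _; rewrite Mr mulr1 mxE.
  have /matrixP /(_ (rshift 3 ord0) (rshift 3 ord0)) := NM.
  rewrite !mxE eqxx => h; apply: etrans h.
  by apply: eq_bigr => i _; rewrite Mr mulr1.
- apply/rowP => k; rewrite summxE mxE.
  have /matrixP /(_ (rshift 3 ord0) (lshift 1 k)) := NM.
  rewrite !mxE eq_rlshift => h; apply: etrans h.
  by apply: eq_bigr => i _; rewrite Ml mxE.
- move=> i j; have /matrixP /(_ j i) := MN.
  rewrite !mxE big_split_ord big_ord1 Mr mul1r eq_sym => h; apply: etrans h.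
  congr (_ + _); apply: eq_bigr => k _.
  by rewrite Ml mxE mulrC.
- move=> y; apply/rowP => k; rewrite summxE.
  transitivity (\sum_l y ord0 l * \sum_i N (lshift 1 k) i * v i ord0 l).
    under [RHS]eq_bigr do rewrite mulr_sumr.
    rewrite exchange_big; apply: eq_bigr => i _; rewrite mxE mulr_suml.
    by apply: eq_bigr => l _; rewrite mxE; ring.
  under eq_bigr do rewrite NMll.
  rewrite (bigD1 k) //= eqxx mulr1 big1 ?addr0 // => l lk.
  by rewrite eq_sym (negPf lk) mulr0.
- move=> y; apply/rowP => k; rewrite summxE.
  transitivity (\sum_l y ord0 l * \sum_i N (lshift 1 l) i * v i ord0 k).
    under [RHS]eq_bigr do rewrite mulr_sumr.
    rewrite exchange_big; apply: eq_bigr => i _; rewrite mxE mulr_suml.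
    by apply: eq_bigr => l _; rewrite mxE; ring.
  under eq_bigr do rewrite NMll.
  rewrite (bigD1 k) //= eqxx mulr1 big1 ?addr0 // => l lk.
  by rewrite (negPf lk) mulr0.
Qed.

End DualBasis.

(** * Circumsphere, convex hull and hulloid of the tetrahedron *)

Section Tetrahedron.
Context {R : realType} (v a : 'I_4 -> 'rV[R]_3) (b : 'I_4 -> R).
Context (a_sum : \sum_i a i = 0) (b_sum : \sum_i b i = 1).
Context (bv_sum : \sum_i b i *: v i = 0).
Context (av : forall i j, dot (a i) (v j) + b i = (i == j)%:R).
Context (a_expand : forall y, \sum_i dot y (v i) *: a i = y).
Context (v_expand : forall y, \sum_i dot y (a i) *: v i = y).
Implicit Types (x c : 'rV[R]_3).

Let V := range v.
Let C := circumcenter V.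
Let r := circumradius V.

(** Subtracting the sphere equations shows that [(c - c').v_i] does not depend on [i], and the [a i]
    sum to zero. *)
Lemma circumcenter_uniq c c' (s s' : R) :
  V `<=` esphere c s -> V `<=` esphere c' s' -> c = c'.
Proof.
move=> cs cs'; apply/eqP; rewrite -subr_eq0; apply/eqP.
have sq d (t : R) : V `<=` esphere d t ->
    forall i, dot (d - v i) (d - v i) = t ^+ 2.
  move=> dt i; have := dt (v i); rewrite /esphere /= edistE => <-;
    last by exists i.
  by rewrite sqr_sqrtr // dot_ge0.
rewrite -(a_expand (c - c')).
transitivity (((dot c c - dot c' c' - s ^+ 2 + s' ^+ 2) / 2) *: \sum_i a i);
  last by rewrite a_sum scaler0.
rewrite scaler_sumr; apply: eq_bigr => i _; congr (_ *: _).
have := sq _ _ cs i; have := sq _ _ cs' i.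
by rewrite !dotB_sqr dotDl dotNl => h h'; lra.
Qed.

Lemma circumcenter_exists : exists c s, V `<=` esphere c s.
Proof.
(* Chosen so that [2 c.v_j = |v_j|^2 - K], by the duality [av]; then [|c - v_j|^2 = |c|^2 + K] for
   all [j]. *)
pose K := \sum_i dot (v i) (v i) * b i.
pose c := (1 / 2 : R) *: \sum_i dot (v i) (v i) *: a i.
exists c, (Num.sqrt (dot c c + K)) => _ [j _ <-].
rewrite /esphere /= edistE; congr Num.sqrt.
rewrite dotB_sqr; suff -> : 2 * dot c (v j) = dot (v j) (v j) - K by ring.
rewrite dotZl dot_suml.
have -> : \sum_i dot (dot (v i) (v i) *: a i) (v j) =
    \sum_i (dot (v i) (v i) * (i == j)%:R - dot (v i) (v i) * b i).
  by apply: eq_bigr => i _; rewrite dotZl -av; ring.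
rewrite sumrB -/K (bigD1 j) //= eqxx mulr1 big1 ?addr0 => [|i ij]; last first.
  by rewrite (negPf ij) mulr0.
by field.
Qed.

(** Center and radius are picked by separate uses of [get]; uniqueness of the center matches
    them. *)
Lemma circumsphere : V `<=` esphere C r.
Proof.
have [c0 [s0 h0]] := circumcenter_exists.
have [s CS] : exists s, V `<=` esphere C s.
  by apply: (@getPex _ [set c | exists s, V `<=` esphere c s]); exists c0, s0.
have [c cS] : exists c, V `<=` esphere c r.
  by apply: (@getPex _ [set s | exists c, V `<=` esphere c s]); exists s0, c0.
by rewrite (circumcenter_uniq CS cS).
Qed.

Lemma convex_hull_coord x i : convex_hull V x -> 0 <= b i + dot x (a i).
Proof.
move=> /(_ [set y | 0 <= b i + dot y (a i)]); apply; split; last first.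
  by move=> _ [j _ <-] /=; rewrite dotC addrC av; case: eqP.
move=> y z t; rewrite !inE /= => y0 z0.
have -> : b i + dot (conv t y z) (a i) =
  t%:num * (b i + dot y (a i)) + (1 - t%:num) * (b i + dot z (a i)).
  by rewrite /conv /= dotDl !dotZl /unstable.onem; ring.
by rewrite addr_ge0 // mulr_ge0 // subr_ge0.
Qed.

Lemma coord_convex_hull x :
  (forall i, 0 <= b i + dot x (a i)) -> convex_hull V x.
Proof.
move=> x0 A [cA VA].
have -> : x = \sum_i (b i + dot x (a i)) *: v i.
  under eq_bigr do rewrite scalerDl.
  by rewrite big_split /= bv_sum v_expand add0r.
apply: convex_set_sum => // [i|]; first by apply: VA; exists i.
by rewrite big_split /= b_sum -dot_sumr a_sum dotC dot0l addr0.
Qed.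

Lemma bary_continuous i : continuous (fun x => b i + dot x (a i)).
Proof.
have dc : continuous (fun x : 'rV[R]_3 => dot x (a i)).
  by apply: dot_continuous => x; [exact: cvg_id | exact: cst_continuous].
move=> x.
exact: (@cvgD _ _ _ (nbhs x) _ (fun=> b i) _ (b i) _ (cvg_cst _) (dc x)).
Qed.

Lemma interior_convex_hull x :
  interior (convex_hull V) x <-> forall i, 0 < b i + dot x (a i).
Proof.
split=> [intx i|x0].
  (* Moving away from [v i] turns the [i]-th coordinate [t] into [(1 + e) t - e], which stays
     nonnegative only if [t > 0]. *)
  have [e [e0 e1 /(convex_hull_coord i)]] :=
    interior_line (x - v i) intx.
  have := av i i; rewrite eqxx /= => avi.
  rewrite dotDl dotZl dotDl dotNl (dotC (v i)).
  have -> : dot (a i) (v i) = 1 - b i by lra.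
  move=> h.
  have : e <= (b i + dot x (a i)) * (1 + e) by lra.
  move=> h'; have e1' : 0 < 1 + e by lra.
  by rewrite -(pmulr_lgt0 _ e1') (lt_le_trans e0).
have near_gt0 i : \forall y \near x, 0 < b i + dot y (a i).
  exact: (cvgr_gt _ (@bary_continuous i x)).
apply: (@filterS _ (nbhs x)) (@filter_forall _ _ _ (nbhs x) _ near_gt0) => y y0.
by apply: coord_convex_hull => i; exact: ltW.
Qed.

Context (well_centered : interior (convex_hull V) C).

Let u i : 'rV[R]_3 := v i - C.
Let lam i := b i + dot C (a i).

Lemma tetrahedron_frame : circumframe u a lam r.
Proof.
have sph i : Defs.edist C (v i) = r by apply: circumsphere; exists i.
have r0 : 0 <= r by rewrite -(sph ord0) edistE sqrtr_ge0.
split=> //.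
- by apply/interior_convex_hull.
- by rewrite big_split /= b_sum -dot_sumr a_sum dotC dot0l addr0.
- under eq_bigr do rewrite scalerBr.
  rewrite sumrB -scaler_suml.
  rewrite [X in X *: C](_ : _ = 1); last first.
    by rewrite big_split /= b_sum -dot_sumr a_sum dotC dot0l addr0.
  under eq_bigr do rewrite scalerDl.
  by rewrite big_split /= bv_sum v_expand add0r scale1r subrr.
- by move=> i j; rewrite -av /u /lam dotDr dotNr (dotC (a i) C); ring.
- move=> y; rewrite -[RHS]a_expand.
  under eq_bigr do rewrite dotDr dotNr scalerBl.
  by rewrite sumrB -scaler_sumr a_sum scaler0 subr0.
- move=> y; rewrite -[RHS]v_expand.
  under eq_bigr do rewrite scalerBr.
  by rewrite sumrB -scaler_suml -dot_sumr a_sum dotC dot0l scale0r subr0.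
- move=> i; have /(edist_eqE _ _ r0) <- := sph i.
  by rewrite /u -(opprB C) dotNl dotNr opprK.
Qed.

Let F := tetrahedron_frame.
Let r_ge0 : 0 <= r := frame_radius_ge0 F.

Lemma gap_outside rho c i : 0 < rho ->
  (0 <= gap u (rho ^+ 2 - r ^+ 2) (c - C) i) = ~~ (Defs.edist c (v i) < rho).
Proof.
move=> rho0; rewrite (gapE F) edist_ltE // -leNgt subrK subr_ge0.
by rewrite /u opprB addrA subrK.
Qed.

Lemma hulloidP rho x : r < rho ->
  hulloid rho V x <-> in_core a lam r (rho ^+ 2 - r ^+ 2) (x - C).
Proof.
move=> r_rho; have rho0 : 0 < rho by exact: le_lt_trans r_rho.
have q0 : 0 < rho ^+ 2 - r ^+ 2.
  by rewrite subr_gt0 ltr_pXn2r ?nnegrE // ltW.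
have swap c : dot (x - C - (c - C)) (x - C - (c - C)) = dot (c - x) (c - x).
  by rewrite opprB addrA subrK -(opprB c) dotNl dotNr opprK.
rewrite (in_coreP F) // subrK; split=> [H y gap0|H c cV].
  move: gap0; rewrite -(addrK C y); move: (y + C) => {y} c gap0.
  have : ~ eball c rho x.
    apply: H; rewrite /= -subset0 => z [zB [i _ zE]].
    have := gap0 i; rewrite gap_outside // => /negP; apply.
    by rewrite zE.
  by rewrite swap /eball /= edist_ltE // => /negP; rewrite -leNgt.
rewrite /eball /= edist_ltE //; apply/negP; rewrite -leNgt -swap; apply: H => i.
rewrite gap_outside //; apply/negP => ci.
have : (eball c rho `&` V) (v i) by split => //; exists i.
by rewrite cV.
Qed.

Lemma vertex_inj : injective v.
Proof.
move=> i j vij; apply/eqP; have := av i j; rewrite -vij av eqxx.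
by case: eqP => // _ /eqP; rewrite oner_eq0.
Qed.

(** The explicit ball shows that [get] has a valid choice; [facet_center_uniq] identifies the center
    of whatever it returns. *)
Lemma facet_ballE i rho : r < rho ->
  facet_ball V (v i) rho =
  eball (C + facet_center a lam (rho ^+ 2 - r ^+ 2) i) rho.
Proof.
move=> r_rho; have rho0 : 0 < rho by exact: le_lt_trans r_rho.
set q := rho ^+ 2 - r ^+ 2.
have q0 : 0 < q by rewrite subr_gt0 ltr_pXn2r ?nnegrE // ltW.
have sphereE c j : esphere c rho (v j) <-> gap u q (c - C) j = 0.
  rewrite /esphere /= (edist_eqE _ _ (ltW rho0)) (gapE F) subrK.
  rewrite /u opprB addrA subrK; split=> [->|/eqP]; first by rewrite subrr.
  by rewrite subr_eq0 => /eqP.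
have [c [E cV ci]] : exists c, [/\ facet_ball V (v i) rho = eball c rho,
    V `\ v i `<=` boundary (facet_ball V (v i) rho)
    & ~ facet_ball V (v i) rho (v i)].
  apply: (@getPex _ [set B | exists c, [/\ B = eball c rho,
    V `\ v i `<=` boundary B & ~ B (v i)]]).
  exists (eball (C + facet_center a lam q i) rho).
  exists (C + facet_center a lam q i); split => //.
    move=> _ [[j _ <-] /= ji]; rewrite boundary_eball // sphereE addrC addKr.
    rewrite (gap_facet_center F) ?(ltW q0) //; case: eqP => [ij|]; last first.
      by rewrite mul0r.
    by case: ji; rewrite ij.
  apply/negP; rewrite -gap_outside // [C + _]addrC addrK.
  rewrite (gap_facet_center F) ?(ltW q0) // mulr_ge0 // ltW //.
  exact: (facet_gap_gt0 F).
rewrite E in cV ci *; congr (eball _ rho).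
rewrite -(subrK C c) [RHS]addrC; congr (_ + _).
apply: (facet_center_uniq F q0).
  by rewrite gap_outside //; apply/negP.
move=> j ji; apply/sphereE; rewrite -boundary_eball //; apply: cV.
split; first by exists j.
by move=> /vertex_inj ij; rewrite ij eqxx in ji.
Qed.

(** A short move from [v i] towards [v j] has [j]-th coordinate [e] strictly between 0 and 1, unlike
    any vertex. *)
Lemma interior_sub_vertices A x : A `<=` V -> ~ interior A x.
Proof.
move=> AV intx; have [i _ vi] := AV _ (nbhs_singleton intx).
have [j ji] := ord4_neq i.
have [e [e0 e1 /AV [k _ vk]]] := interior_line (v j - v i) intx.
have := av j k; rewrite vk -vi !dotE.
have := av j j; rewrite eqxx; have := av j i; rewrite (negPf ji) /=.
set p := dot _ _; set p' := dot _ _ => h1 h2.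
have -> : p = - b j by lra.
have -> : p' = 1 - b j by lra.
by case: eqP => _ /=; lra.
Qed.

Lemma baryE x i : bary a lam (x - C) i = b i + dot x (a i).
Proof. by rewrite /bary /lam !dotE; ring. Qed.

(** * The critical radius *)

Section Critical.
Context (q : R) (q_gt0 : 0 < q).
Context (q_root : excess u r (fun i => (facet_gap a lam q i)^-1) = 0).

Let O : 'rV[R]_3 := C + apex u a lam q.
Let Rs : R := Num.sqrt (q + r ^+ 2).

Let OC : O - C = apex u a lam q.
Proof. by rewrite /O addrC addKr. Qed.

Let Rs_sqr : Rs ^+ 2 - r ^+ 2 = q.
Proof. by rewrite sqr_sqrtr ?addrK // addr_ge0 ?sqr_ge0 // ltW. Qed.

Let r_lt_Rs : r < Rs.
Proof.
rewrite -[ltLHS](ger0_norm r_ge0) -sqrtr_sqr ltr_sqrt ?ltrDr //.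
by rewrite ltr_pwDl // sqr_ge0.
Qed.

Let Rs_gt0 : 0 < Rs.
Proof. exact: le_lt_trans r_lt_Rs. Qed.

Let sqrB_lt (s t : R) : 0 <= s -> s < t -> s ^+ 2 - r ^+ 2 < t ^+ 2 - r ^+ 2.
Proof.
move=> s0 st; rewrite ltrD2r ltr_pXn2r ?nnegrE //.
by rewrite (le_trans s0) // ltW.
Qed.

(** Points on the circumsphere are vertices by [in_core_sphere]; points inside it fall under
    [in_core_inside]. *)
Lemma hulloid_le_critical rho x : r < rho -> rho <= Rs ->
  hulloid rho V x -> V x \/ (rho = Rs /\ x = O).
Proof.
move=> r_rho rho_Rs /(hulloidP _ r_rho) xc.
have rho0 : 0 <= rho by rewrite (le_trans r_ge0) // ltW.
have [le_r _] := xc; move: le_r; rewrite le_eqVlt => /orP [/eqP xr|xr].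
  have [i xi] := in_core_sphere F xc xr.
  by left; exists i => //; rewrite -(subrK C x) xi /u subrK.
have q'0 : 0 < rho ^+ 2 - r ^+ 2 by rewrite -(subrr (r ^+ 2)) sqrB_lt.
have q'q : rho ^+ 2 - r ^+ 2 <= q.
  move: rho_Rs; rewrite le_eqVlt => /orP [/eqP ->|lt_rho].
    by rewrite Rs_sqr.
  by rewrite -Rs_sqr ltW // sqrB_lt.
have [qE xE] := in_core_inside F q_root q'0 q'q xc xr.
right; split; last by rewrite /O -xE addrC subrK.
apply/eqP; rewrite eq_le rho_Rs leNgt; apply/negP => lt_rho.
by have := sqrB_lt rho0 lt_rho; rewrite Rs_sqr qE ltxx.
Qed.

(** Beyond [Rs] the inequalities of [in_core] are strict at [O], hence persist nearby by
    continuity. *)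
Lemma hulloid_full_above rho : Rs < rho -> hulloid_full rho V.
Proof.
move=> Rs_rho; have r_rho := lt_trans r_lt_Rs Rs_rho.
have qq' : q < rho ^+ 2 - r ^+ 2 by rewrite -Rs_sqr sqrB_lt // ltW.
set q' := rho ^+ 2 - r ^+ 2 in qq'.
have distC x : dot (x - C) (x - C) = dot (C - x) (C - x).
  by rewrite -(opprB C) dotNl dotNr opprK.
pose h i x := (b i + dot x (a i)) * facet_gap a lam q' i
  + dot (C - x) (C - x) - r ^+ 2.
have hc i : continuous (h i).
  move=> x; apply: (@cvgB _ _ _ (nbhs x)); last exact: cvg_cst.
  apply: (@cvgD _ _ _ (nbhs x)); last exact: dist_continuous.
  by apply: (@cvgM _ _ (nbhs x)); [exact: bary_continuous|exact: cvg_cst].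
have h0 i : 0 < h i O.
  have := in_core_apex_strict F q_gt0 q_root i qq'.
  by rewrite /h -OC baryE -distC OC; lra.
have near1 : \forall x \near O, dot (C - x) (C - x) < r ^+ 2.
  apply: (cvgr_lt _ (@dist_continuous _ _ C O)).
  by rewrite -distC OC; exact: (apex_inside F q_root).
have near2 : \forall x \near O, forall i, 0 < h i x.
  apply: (@filter_forall _ _ _ (nbhs O)) => i.
  exact: (cvgr_gt _ (@hc i O) _ (h0 i)).
exists O; apply: (@filterS2 _ (nbhs O)) near1 near2 => x x1 x2.
apply/(hulloidP _ r_rho); split; first by rewrite distC ltW.
by move=> i; have := x2 i; rewrite baryE distC /h -/q'; lra.
Qed.

(** Below [Rs] the hulloid lies in [V] and has empty interior; above [Rs] it is full. *)
Lemma lower_radiusE : lower_radius V = Rs.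
Proof.
rewrite /lower_radius -/r; set A := [set _ | _].
have Alb : lbound A Rs.
  move=> rho [r_rho [x xint]]; rewrite leNgt; apply/negP => lt_rho.
  apply: (@interior_sub_vertices (hulloid rho V) x) xint => y.
  move=> /(hulloid_le_critical r_rho (ltW lt_rho)) [//|[rhoE _]].
  by rewrite rhoE ltxx in lt_rho.
have Aabove rho : Rs < rho -> A rho.
  by move=> lt_rho; split; [exact: lt_trans lt_rho | exact: hulloid_full_above].
apply/eqP; rewrite eq_le; apply/andP; split.
  apply/ler_addgt0Pr => e e0; apply: ge_inf; first by exists Rs.
  by apply: Aabove; rewrite ltrDl.
apply: lb_le_inf => //; exists (Rs + 1); apply: Aabove.
by rewrite ltrDl.
Qed.

Lemma tetrahedron_critical :
  r < lower_radius V /\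
  exists O : 'rV[R]_3,
    [/\ interior (convex_hull V) O,
        forall i : 'I_4, boundary (facet_ball V (v i) (lower_radius V)) O
      & hulloid (lower_radius V) V = V `|` [set O]].
Proof.
rewrite lower_radiusE; split=> //; exists O; split.
- apply/interior_convex_hull => i; rewrite -baryE OC.
  exact: (bary_apex_gt0 F).
- move=> i; rewrite facet_ballE // boundary_eball // Rs_sqr.
  apply/(edist_eqE _ _ (ltW Rs_gt0)).
  rewrite -(opprB O) dotNl dotNr opprK opprD addrA OC.
  by rewrite (apex_facet_center F q_gt0 q_root) -Rs_sqr subrK.
- apply/seteqP; split=> [x /(hulloid_le_critical r_lt_Rs (lexx _))|x].
    by case=> [?|[_ ?]]; [left|right].
  move=> xVO; apply/(hulloidP _ r_lt_Rs); rewrite Rs_sqr.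
  case: xVO => [[i _ <-]|->]; first exact: (in_core_vertex F).
  by rewrite OC; exact: (in_core_apex F q_root).
Qed.

End Critical.

End Tetrahedron.

Theorem theorem4p10 (R : realType) (v : 'I_4 -> 'rV[R]_3)
    (v_nondeg : affinely_independent v)
    (well_centered :
      interior (convex_hull (range v)) (circumcenter (range v))) :
  circumradius (range v) < lower_radius (range v) /\
  exists O : 'rV[R]_3,
    [/\ interior (convex_hull (range v)) O,
        forall i : 'I_4,
          boundary (facet_ball (range v) (v i) (lower_radius (range v))) O
      & hulloid (lower_radius (range v)) (range v) = range v `|` [set O]].
Proof.
have [a [b [[a_sum b_sum] bv_sum av a_expand v_expand]]] := dual_basis v_nondeg.
have F :=
  tetrahedron_frame a_sum b_sum bv_sum av a_expand v_expand well_centered.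
have [q q_gt0 q_root] := excess_root F.
exact: (tetrahedron_critical a_sum b_sum bv_sum av a_expand v_expand
  well_centered q_gt0 q_root).
Qed.
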